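(* Let $A$ be a finite group acting coprimely by automorphisms on a finite group $G$. Assume that all Sylow subgroups of $G$ are cyclic. Then: (a) $C_G(A)$ is a Hall subgroup of $G$; (b) $G=[G,A]\rtimes C_G(A)$; (c) the group $[G,A]$ is cyclic.
   Context: The action of $A$ on $G$ is coprime if $\gcd(|A|,|G|)=1$. $C_G(A)$ is the subgroup of elements of $G$ fixed by every element of $A$, and $[G,A]$ is the subgroup of $G$ generated by all $g^{-1}g^{a}$ with $g\in G$, $a\in A$ (a normal subgroup of $G$). A Hall subgroup is a subgroup whose order is coprime to its index. The notation $G=N\rtimes C$ means $N\trianglelefteq G$, $G=NC$ and $N\cap C=1$. *)

(* Defs.v *)
From mathcomp Require Import all_boot all_fingroup all_solvable.

Set Implicit Arguments.
Unset Strict Implicit.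
Unset Printing Implicit Defensive.

Local Open Scope group_scope.

(* [G, A] for an external action: the library's [~: G, A] only makes sense     *)
(* when A and G live in a common group. As for gacent, only the part of A     *)
(* inside the domain D, and of S inside the range R, is taken into account.   *)
Definition gact_comm (aT rT : finGroupType) (D : {set aT}) (R : {set rT})
    (to : groupAction D R) (S : {set rT}) (A : {set aT}) : {set rT} :=
  <<[set g^-1 * to g a | g in R :&: S, a in D :&: A]>>.

Canonical gact_comm_group (aT rT : finGroupType) (D : {set aT}) (R : {set rT})
    (to : groupAction D R) (S : {set rT}) (A : {set aT}) : {group rT} :=
  Eval hnf in [group of gact_comm to S A].

(* Main.v *)
Require Import Defs.
From mathcomp Require Import all_boot all_fingroup all_solvable.

Set Implicit Arguments.
Unset Strict Implicit.
Unset Printing Implicit Defensive.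

Local Open Scope group_scope.

(** The groups A and G are first placed inside one group, the semidirect product
    of G by A, so that [G, A] becomes a commutator subgroup and C_G(A) a
    centraliser.

    The key point is that the Fitting subgroup F of G is nilpotent with cyclic
    Sylow subgroups, hence cyclic, so that its automorphism group is abelian.
    Both G and A act on F by conjugation, and since the image of G A in Aut F is
    abelian, [G, A] acts trivially on F.  But G is solvable, so that C_G(F) is
    contained in F ([cent_sub_Fitting]), and [G, A] is therefore a subgroup of
    the cyclic group F ([Zgroup_comm_cyclic]).

    Coprimality gives G = [G, A] C_G(A) and [G, A, A] = [G, A] for solvable G;
    as [G, A] is abelian, C_{[G, A]}(A) = C_{[G, A, A]}(A) = 1, so the product
    is semidirect ([Zgroup_coprime_sdprod]).  If a prime p divided the orders of
    both factors, then the subgroup of order p of the cyclic normal subgroup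
    [G, A] would be normal in G, and hence would be the unique subgroup of order
    p in each Sylow p-subgroup; a subgroup of order p of C_G(A) would coincide
    with it, contradicting [G, A] :&: C_G(A) = 1.  So C_G(A) is a Hall subgroup
    ([Zgroup_coprime_cent_Hall]).

    Solvability of G ([Zgroup_sol]) comes from Burnside's transfer theorem
    ([Burnside_normal_complement]): for the least prime p dividing |G|, a cyclic
    Sylow p-subgroup P is central in its normaliser, so it has a normal
    complement, to which induction applies. *)

(** * Solvability of groups with cyclic Sylow subgroups *)

(** The group of automorphisms that 'N_G(P) induces on P has order prime to p,
    because the Sylow subgroup P acts trivially on itself, and dividing
    totient (p ^ k) = (p - 1) * p ^ (k - 1). A prime divisor of that order would
    divide both p - 1 and #|G|, against the minimality of p. *)
Lemma min_cyclic_Sylow_norm_cent (gT : finGroupType) (G P : {group gT}) :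
  (pdiv #|G|).-Sylow(G) P -> cyclic P -> 'N_G(P) \subset 'C(P).
Proof.
set p := pdiv _ => sylP cycP.
have [sPG pP p'iPG] := and3P sylP.
have [G1 | ntG] := eqVneq G 1%G.
  by rewrite (subset_trans (subsetIl _ _)) // G1 sub1G.
have p_pr: prime p by rewrite pdiv_prime // cardG_gt1.
have sNN : 'N_G(P) \subset 'N(P) := subsetIr _ _.
pose M := conj_aut P @* 'N_G(P).
have p'M: p^'.-nat #|M|.
  rewrite card_morphim (setIidPr sNN); apply: pnat_dvd p'iPG.
  apply: (@dvdn_trans #|'N_G(P) : P|); last first.
    by rewrite indexSg ?subsetIl // subsetI sPG normG.
  apply: indexgS; rewrite /= ker_conj_aut; exact: cyclic_abelian.
have dvM: #|M| %| totient #|P|.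
  by rewrite -card_Aut_cyclic // cardSg ?Aut_conj_aut.
have M1: #|M| = 1%N.
  apply: contraTeq dvM => ntM; apply/negP=> dvM.
  have m_gt1: 1 < #|M| by rewrite ltn_neqAle eq_sym ntM cardG_gt0.
  set q := pdiv #|M|; have q_pr: prime q := pdiv_prime m_gt1.
  have qM: q %| #|M| := pdiv_dvd _.
  have qp: q != p by apply: (pnatPpi p'M); rewrite pi_pdiv.
  have le_pq: p <= q.
    rewrite pdiv_min_dvd ?prime_gt1 // (dvdn_trans qM) //.
    by rewrite (dvdn_trans (dvdn_morphim _ _)) ?cardSg ?subsetIl //.
  have := dvdn_trans qM dvM; rewrite (card_Hall sylP) p_part.
  case: (logn p #|G|) => [|k]; first by rewrite dvdn1; case: (q) q_pr => [|[]].
  rewrite totient_pfactor // Euclid_dvdM // Euclid_dvdX //.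
  rewrite (dvdn_prime2 q_pr p_pr).
  have p1_gt0: 0 < p.-1 by rewrite -subn1 subn_gt0 prime_gt1.
  rewrite (negPf qp) andFb orbF => /(dvdn_leq p1_gt0).
  by rewrite leqNgt (leq_trans _ le_pq) // ltn_predL prime_gt0.
move/eqP: M1; rewrite -trivg_card1 -subG1 sub_morphim_pre //.
by rewrite [_ @*^-1 1]ker_conj_aut.
Qed.

(** An abelian Sylow subgroup controls fusion: P and P :^ z are both Sylow
    subgroups of the centraliser of y ^ z, hence conjugate there, and an element
    conjugating one to the other corrects z into an element of 'N_G(P). *)
Lemma Burnside_fusion (gT : finGroupType) p (G P : {group gT}) :
  p.-Sylow(G) P -> abelian P ->
  {in P & G, forall y z, y ^ z \in P ->
    exists2 n, n \in 'N_G(P) & y ^ z = y ^ n}.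
Proof.
move=> sylP cPP y z Py Gz Pyz; have [sPG _ _] := and3P sylP.
pose C := 'C_G[y ^ z].
have sPC: P \subset C.
  by rewrite subsetI sPG sub_cent1 (subsetP cPP).
have sPzC: P :^ z \subset C.
  rewrite subsetI -{1}(conjGid Gz) conjSg sPG sub_cent1 centJ memJ_conjg.
  by rewrite (subsetP cPP).
have sylPC: p.-Sylow(C) P := pHall_subl sPC (subsetIl _ _) sylP.
have sylPzC: p.-Sylow(C) (P :^ z).
  by apply: (pHall_subl sPzC (subsetIl _ _)); rewrite pHallJ.
have [c Cc defP] := Sylow_trans sylPzC sylPC.
have [Gc /cent1P cyz] := setIP Cc.
exists (z * c).
  rewrite inE groupM //=; apply/normP.
  by rewrite conjsgM -defP.
by rewrite conjgM (conjgE (y ^ z)) -cyz mulKg.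
Qed.

(** The complement is the kernel of the transfer V of G into P. On P the
    transfer is g |-> g ^+ #|G : P|, since every conjugate of a power of g that
    occurs in it equals that power by fusion; so V is injective on P, and its
    kernel meets P trivially while having index at most #|P|. *)
Lemma Burnside_normal_complement (gT : finGroupType) p (G P : {group gT}) :
    p.-Sylow(G) P -> 'N_G(P) \subset 'C(P) ->
  exists K : {group gT}, K ><| P = G.
Proof.
move=> sylP cNP; have [sPG pP p'iPG] := and3P sylP.
have cPP: abelian P.
  by rewrite /abelian (subset_trans _ cNP) // subsetI sPG normG.
(* The transfer goes to the abelian group attached to the image of a morphism
   with domain P; here this is the identity of P. *)
have cQQ: abelian (idm P @* P) by rewrite morphim_idm.
pose V := transfer_morphism G cQQ.
have VE: {in P, forall g,
    FiniteModule.fmval (transfer G cQQ g) = g ^+ #|G : P|}.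
  move=> g Pg; have Gg := subsetP sPG g Pg.
  have trX := transversalP (rcosets_cycle_partition sPG Gg).
  set X := transversal _ _ in trX; have sXG := transversal_sub trX.
  rewrite (transfer_cycle_expansion sPG cQQ Gg trX) FiniteModule.fmval_sum.
  rewrite -(sum_index_rcosets_cycle sPG Gg trX).
  apply: (big_ind2 (fun a n => a = g ^+ n)) => // [a m b n -> -> | x Xx].
    by rewrite expgD.
  have Gx := subsetP sXG x Xx; set n := #|_ : _|.
  have Pgn: g ^+ n \in P by rewrite groupX.
  have Pgnx: (g ^+ n) ^ x^-1 \in P.
    rewrite conjgE invgK mulgA -mem_rcoset; exact: mulg_exp_card_rcosets.
  rewrite /restrm /= FiniteModule.fmodK; last first.
    by rewrite /= morphim_idm ?sub1set.
  have Gx' : x^-1 \in G by rewrite groupV.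
  have [c Nc ->] := Burnside_fusion sylP cPP Pgn Gx' Pgnx.
  by rewrite conjgE -(centP (subsetP cNP c Nc) _ Pgn) mulKg.
pose K : {group gT} := [group of 'ker V]; have nsKG: K <| G := ker_normal V.
have tiKP: K :&: P = 1.
  apply/trivgP/subsetP=> g; rewrite inE => /andP[/mker Vg1 Pg].
  have /eqP: g ^+ #|G : P| = 1 by rewrite -VE // [transfer _ _ _]Vg1.
  rewrite -order_dvdn inE -order_eq1 -dvdn1 => dv_g.
  by rewrite -(eqnP (pnat_coprime (mem_p_elt pP Pg) p'iPG)) dvdn_gcd dvdnn.
have leVG: #|V @* G| <= #|P|.
  have sQP: idm P @* P \subset P by rewrite morphim_idm.
  have inj_fmval: injective (@FiniteModule.fmval gT _ cQQ) := val_inj.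
  rewrite -(card_imset _ inj_fmval) subset_leq_card //.
  apply/subsetP=> _ /imsetP[u _ ->].
  exact: subsetP sQP _ (FiniteModule.fmodP u).
have defG : K * P = G.
  apply/eqP; rewrite eqEcard mul_subG ?(normal_sub nsKG) //= (TI_cardMg tiKP).
  rewrite -(Lagrange (normal_sub nsKG)) leq_mul2l.
  by rewrite card_morphim setIid in leVG; rewrite leVG orbT.
exists K; rewrite sdprodE //; exact: subset_trans sPG (normal_norm nsKG).
Qed.

Lemma Zgroup_sol (gT : finGroupType) (G : {group gT}) : Zgroup G -> solvable G.
Proof.
have [n] := ubnP #|G|; elim: n gT G => // n IHn gT G leGn ZG.
have [-> | ntG] := eqVneq G 1%G; first exact: solvable1.
have p_pr: prime (pdiv #|G|) by rewrite pdiv_prime // cardG_gt1.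
have [P sylP] := Sylow_exists (pdiv #|G|) G.
have cycP: cyclic P.
  by apply: (forall_inP ZG); apply/SylowP; exists (pdiv #|G|).
have ntP: P :!=: 1.
  by rewrite -rank_gt0 (rank_Sylow sylP) p_rank_gt0 pi_pdiv cardG_gt1.
have cNP := min_cyclic_Sylow_norm_cent sylP cycP.
have [K defG] := Burnside_normal_complement sylP cNP.
have [nsKG sPG mulKP nKP tiKP] := sdprod_context defG.
rewrite (series_sol nsKG) -(isog_sol (sdprod_isog defG)).
rewrite (abelian_sol (cyclic_abelian cycP)) andbT.
apply: IHn (ZgroupS (normal_sub nsKG) ZG); rewrite -ltnS.
apply: leq_trans leGn; rewrite ltnS -(sdprod_card defG).
by rewrite ltn_Pmulr ?cardG_gt0 // cardG_gt1.
Qed.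

(** * The Fitting subgroup of a solvable group *)

(** If C = 'C_G(F) were not contained in F, it would strictly contain
    Z = C :&: F, and by solvability C / Z
    would contain a nontrivial abelian normal subgroup M / Z of G / Z. As Z is
    central in M, this M would be nilpotent, hence contained in F and so in
    Z. *)
Lemma cent_sub_Fitting (gT : finGroupType) (G : {group gT}) :
  solvable G -> 'C_G('F(G)) \subset 'F(G).
Proof.
move=> solG; set F := 'F(G); set C := 'C_G(F).
have nsFG: F <| G := Fitting_normal G.
have [sFG nFG] := andP nsFG.
have nsCG: C <| G by rewrite /normal subsetIl normsI ?normG ?norms_cent.
have solC: solvable C := solvableS (subsetIl _ _) solG.
pose Z := C :&: F; have sZC: Z \subset C := subsetIl _ _.
have nsZG: Z <| G by rewrite normalI.
apply: contraT => not_sCF.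
have ntCZ: C / Z != 1.
  apply: contra not_sCF => /eqP CZ1.
  have nZC: C \subset 'N(Z).
    exact: subset_trans (normal_sub nsCG) (normal_norm nsZG).
  by have:= quotient_sub1 nZC; rewrite CZ1 subxx subsetI => /esym/andP[].
have [Mb [sMbC nsMbG ntMb abMb]] :=
  solvable_norm_abelem (quotient_sol Z solC) (quotient_normal Z nsCG) ntCZ.
have [M defMb sZM nsMG] := inv_quotientN nsZG nsMbG.
have [sMG nMG] := andP nsMG.
have nZM: M \subset 'N(Z) := subset_trans sMG (normal_norm nsZG).
have sMC: M \subset C by rewrite -(quotientSGK nZM sZC) -defMb.
have sM'Z: M^`(1) \subset Z.
  by have /and3P[_ cMb _] := abMb; rewrite der1_min // -defMb.
have sZZM: Z \subset 'Z(M).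
  rewrite subsetI sZM (subset_trans (subsetIr _ _)) // centsC.
  exact: subset_trans sMC (subsetIr _ _).
have nilM: nilpotent M.
  rewrite -quotient_center_nil abelian_nil // sub_der1_abelian //.
  exact: subset_trans sM'Z sZZM.
have sMF: M \subset F := Fitting_max nsMG nilM.
by rewrite -subG1 defMb quotient_sub1 // subsetI sMC sMF in ntMb.
Qed.

(** * Coprime action inside a common group *)

(** Both G and A act on the cyclic group 'F(G), whose automorphism group is
    abelian; so [~: G, A] centralises 'F(G), hence is contained in it. *)
Lemma Zgroup_comm_cyclic (gT : finGroupType) (A G : {group gT}) :
  A \subset 'N(G) -> Zgroup G -> cyclic [~: G, A].
Proof.
move=> nGA ZG.
have cycF: cyclic 'F(G).
  exact: nil_Zgroup_cyclic (ZgroupS (Fitting_sub G) ZG) (Fitting_nil G).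
apply: (cyclicS _ cycF); apply: subset_trans (cent_sub_Fitting (Zgroup_sol ZG)).
rewrite subsetI commg_subl nGA.
have nFGA: G <*> A \subset 'N('F(G)) by rewrite join_subG gFnorm gFnorm_trans.
apply: subset_trans (_ : (G <*> A)^`(1) \subset _).
  by rewrite derg1 commgSS ?joing_subl ?joing_subr.
rewrite -ker_conj_aut ker_trivg_morphim gFsub_trans // morphim_der //.
have cAut := Aut_cyclic_abelian cycF.
by rewrite (sameP trivgP derG1P) (abelianS (Aut_conj_aut _ _)).
Qed.

(** A acts trivially on G / [~: G, A], and in a coprime action the fixed points
    of a quotient lift to fixed points. *)
Lemma coprime_comm_cent_mul (gT : finGroupType) (A G : {group gT}) :
    A \subset 'N(G) -> coprime #|G| #|A| -> solvable G ->
  [~: G, A] * 'C_G(A) = G.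
Proof.
move=> nGA coGA solG.
have sKG: [~: G, A] \subset G by rewrite commg_subl.
have nKG: G \subset 'N([~: G, A]) := commg_norml G A.
have nKA: A \subset 'N([~: G, A]) := commg_normr A G.
have sCG: 'C_G(A) \subset G := subsetIl _ _.
apply/eqP; rewrite eqEsubset mul_subG //=.
rewrite -quotientSK // coprime_norm_quotient_cent //; last 2 first.
- exact: coprimeSg coGA.
- exact: solvableS sKG solG.
by rewrite subsetI subxx /= quotient_cents2 /= ?subxx ?nKG ?nKA.
Qed.

(** Since G = [~: G, A] * 'C_G(A), commutators with A only see the first
    factor. *)
Lemma coprime_comm_idem (gT : finGroupType) (A G : {group gT}) :
    A \subset 'N(G) -> coprime #|G| #|A| -> solvable G ->
  [~: G, A, A] = [~: G, A].
Proof.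
move=> nGA coGA solG; apply/eqP; rewrite eqEsubset commg_subl commg_normr /=.
rewrite -{1}(coprime_comm_cent_mul nGA coGA solG) commMG.
  by rewrite (commG1P (subsetIr _ _)) mulg1.
rewrite normsR //; first by rewrite (subset_trans (subsetIl _ _)) ?commg_norml.
by rewrite (subset_trans (subsetIr _ _)) ?cent_sub.
Qed.

(** As [~: G, A] = [~: G, A, A] is abelian, A has no nontrivial fixed point in
    it. *)
Lemma Zgroup_coprime_sdprod (gT : finGroupType) (A G : {group gT}) :
    A \subset 'N(G) -> coprime #|G| #|A| -> Zgroup G ->
  [~: G, A] ><| 'C_G(A) = G.
Proof.
move=> nGA coGA ZG; have solG := Zgroup_sol ZG.
have sKG: [~: G, A] \subset G by rewrite commg_subl.
have cKK := cyclic_abelian (Zgroup_comm_cyclic nGA ZG).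
have tiKC: [~: G, A] :&: 'C_G(A) = 1.
  rewrite setIA (setIidPl sKG) -{1}(coprime_comm_idem nGA coGA solG).
  by rewrite coprime_abel_cent_TI ?commg_normr ?(coprimeSg sKG).
rewrite sdprodE ?coprime_comm_cent_mul //.
by rewrite (subset_trans (subsetIl _ _)) ?commg_norml.
Qed.

(** A common prime p of #|[~: G, A]| and #|'C_G(A)| would give subgroups of
    order p in both. The one in the cyclic normal subgroup [~: G, A] is normal
    in G, so it lies in every Sylow p-subgroup; these being cyclic, the two
    subgroups would be equal. *)
Lemma Zgroup_coprime_cent_Hall (gT : finGroupType) (A G : {group gT}) :
    A \subset 'N(G) -> coprime #|G| #|A| -> Zgroup G ->
  Hall G 'C_G(A).
Proof.
move=> nGA coGA ZG; have defG := Zgroup_coprime_sdprod nGA coGA ZG.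
have [_ _ _ _ tiKC] := sdprod_context defG.
rewrite -(coprime_sdprod_Hall_r defG).
have cycK := Zgroup_comm_cyclic nGA ZG.
have sKG: [~: G, A] \subset G by rewrite commg_subl.
have sCG: 'C_G(A) \subset G := subsetIl _ _.
rewrite coprime_has_primes ?cardG_gt0 //; apply/hasPn=> p.
rewrite !mem_primes !cardG_gt0 /= => /andP[p_pr pC]; apply/negP=> /andP[_ pK].
have [x Cx ox] := Cauchy p_pr pC; have [y Ky oy] := Cauchy p_pr pK.
have sxC: <[x]> \subset 'C_G(A) by rewrite cycle_subG.
have syK: <[y]> \subset [~: G, A] by rewrite cycle_subG.
have sxG := subset_trans sxC sCG.
have p_x: p.-group <[x]> by rewrite /pgroup -orderE ox pnat_id.
have p_y: p.-group <[y]> by rewrite /pgroup -orderE oy pnat_id.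
have [P sylP sxP] := Sylow_superset sxG p_x.
have nsyG: <[y]> <| G.
  apply: (@char_normal_trans _ [~: G, A]%G); first by rewrite sub_cyclic_char.
  by rewrite /normal sKG commg_norml.
have syP: <[y]> \subset P.
  by rewrite (subset_trans _ (pcore_sub_Hall sylP)) // pcore_max.
have cycP: cyclic P by apply: (forall_inP ZG); apply/SylowP; exists p.
have exy: <[x]> :==: <[y]>.
  by rewrite (eq_subG_cyclic cycP) // -!orderE ox oy.
have : x \in [~: G, A] :&: 'C_G(A).
  by rewrite inE Cx andbT (subsetP syK) // -(eqP exy) cycle_id.
by rewrite tiKC => /set1P x1; rewrite -ox x1 order1 in p_pr.
Qed.

(** * The external action *)

Theorem proposition1p7 (aT rT : finGroupType) (A : {group aT}) (G : {group rT})
    (to : groupAction A G) (coAG : coprime #|A| #|G|) (ZG : Zgroup G) :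
  [/\ Hall G 'C_(|to)(A),
      gact_comm to G A ><| 'C_(|to)(A) = G
    & cyclic (gact_comm to G A)].
Proof.
pose inG := sdpair1_morphism to; pose inA := sdpair2_morphism to.
have injG : 'injm inG := injm_sdpair1 _.
have injA : 'injm inA := injm_sdpair2 _.
have nGA : inA @* A \subset 'N(inG @* G) := im_sdpair_norm to.
have coGA : coprime #|inG @* G| #|inA @* A|.
  by rewrite !card_injm // coprime_sym.
have ZG' := morphim_Zgroup inG ZG.
have defC : inG @* 'C_(|to)(A) = 'C_(inG @* G)(inA @* A).
  by rewrite gacentEsd -morphpreIim morphpreK ?subsetIl.
have sCG : 'C_(|to)(A) \subset G := subsetIl _ _.
have s0G : [set g^-1 * to g a | g in G :&: G, a in A :&: A] \subset G.
  apply/subsetP=> w /imset2P[g a]; rewrite !setIid => Gg Aa ->.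
  by rewrite groupM ?groupV ?gact_stable.
have sKG : gact_comm to G A \subset G by rewrite gen_subG.
have defK : inG @* gact_comm to G A = [~: inG @* G, inA @* A].
  rewrite morphim_gen //; congr <<_>>.
  have im_comm g a: g \in G -> a \in A ->
    inG (g^-1 * to g a) = [~ inG g, inA a].
  - move=> Gg Aa; rewrite morphM ?groupV ?gact_stable // morphV //=.
    by rewrite sdpair_act.
  apply/setP=> z; apply/morphimP/imset2P.
    case=> w _ /imset2P[g a]; rewrite !setIid => Gg Aa -> ->.
    by exists (inG g) (inA a); rewrite ?mem_morphim ?im_comm.
  case=> u v /morphimP[g _ Gg ->] /morphimP[a _ Aa ->] ->.
  exists (g^-1 * to g a); rewrite ?im_comm ?groupM ?groupV ?gact_stable //.
  by apply/imset2P; exists g a; rewrite ?setIid.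
split.
- have /andP[_] := Zgroup_coprime_cent_Hall nGA coGA ZG'.
  by rewrite -defC -divgS ?morphimS // !card_injm // divgS // /Hall sCG.
- have defG: inG @* gact_comm to G A ><| inG @* 'C_(|to)(A) = inG @* G.
    rewrite defC defK; exact: Zgroup_coprime_sdprod.
  have := injm_sdprod (subxx _) (injm_invm injG) defG.
  by rewrite !morphim_invm.
by rewrite -(injm_cyclic injG) // defK Zgroup_comm_cyclic.
Qed.
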